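(* Let $n\ge3$, let $CL_n$ be the circular ladder graph and let $H_{n-1}$ be its induced $(n-1)$-independent graph. If $n$ is odd, then $H_{n-1}$ is isomorphic to $CL_n$ as a graph, so $\mathcal{N}(H_{n-1})$ is homeomorphic to $\mathcal{N}(CL_n)$, and it is homotopy equivalent to $\mathbb{S}^1$. If $n$ is even, then $\mathcal{N}(H_{n-1})$ is homotopy equivalent to $\mathbb{S}^0$.
   Context: The circular ladder graph $CL_n$ has $2n$ vertices $\{i^+,i^-:1\le i\le n\}$ and edges $i^+(i+1)^+$, $i^-(i+1)^-$ and $i^+i^-$ for $1\le i\le n$, indices modulo $n$. For a graph $G$, its induced $k$-independent graph $H_k$ has as vertices the independent sets of size $k$ in $G$, two being adjacent iff they are disjoint. The neighborhood complex $\mathcal{N}(H)$ of a graph $H$ is the simplicial complex on its vertex set whose simplices are the sets of vertices having a common neighbor. *)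

(* Defs.v *)
From HB Require Import structures.
From mathcomp Require Import all_boot all_order all_algebra.
From mathcomp Require Import all_classical all_reals topology normedtype.

Set Implicit Arguments.
Unset Strict Implicit.
Unset Printing Implicit Defensive.

Import Order.TTheory GRing.Theory Num.Theory.
Import numFieldNormedType.Exports.

Local Open Scope classical_set_scope.
Local Open Scope ring_scope.

Record sgraph := SGraph {
  vertex :> finType;
  edge : rel vertex;
  edge_sym : symmetric edge;
  edge_irrefl : irreflexive edge }.

Definition graph_isomorphic (G H : sgraph) : Prop :=
  exists f : G -> H,
    bijective f /\ (forall x y : G, edge (f x) (f y) = edge x y).

(* The vertex i^+ is (i, true) and i^- is (i, false), with i in {0, .., n-1};
   ordS is the successor modulo n.  The test x != y only removes the loops that
   would arise at n = 1. *)
Definition CL_edge (n : nat) : rel ('I_n * bool) := fun x y =>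
  (x != y) &&
  [|| (x.2 == y.2) && (y.1 == ordS x.1),
      (x.2 == y.2) && (x.1 == ordS y.1)
    | (x.1 == y.1) && (x.2 != y.2)].

Lemma CL_edge_sym n : symmetric (@CL_edge n).
Proof.
move=> x y; rewrite /CL_edge ![y == x]eq_sym ![y.1 == x.1]eq_sym.
by rewrite ![y.2 == x.2]eq_sym orbCA.
Qed.

Lemma CL_edge_irrefl n : irreflexive (@CL_edge n).
Proof. by move=> x; rewrite /CL_edge eqxx. Qed.

Definition CL (n : nat) : sgraph := SGraph (@CL_edge_sym n) (@CL_edge_irrefl n).

Section IndependentGraph.
Variables (G : sgraph) (k : nat).

Definition independent (A : {set G}) : bool :=
  [forall x in A, forall y in A, ~~ edge x y].

Definition kindep : finType :=
  {A : {set G} | independent A && (#|A| == k)}.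

(* The test A != B only matters for k = 0, where the empty set is disjoint from
   itself. *)
Definition kindep_edge : rel kindep := fun A B =>
  (A != B) && [disjoint val A & val B].

Lemma kindep_edge_sym : symmetric kindep_edge.
Proof. by move=> A B; rewrite /kindep_edge eq_sym disjoint_sym. Qed.

Lemma kindep_edge_irrefl : irreflexive kindep_edge.
Proof. by move=> A; rewrite /kindep_edge eqxx. Qed.

Definition indep_graph : sgraph := SGraph kindep_edge_sym kindep_edge_irrefl.

End IndependentGraph.

(* The empty face is allowed; it contributes no point to the realization. *)
Record simplicial_complex (V : finType) := SimplicialComplex {
  faces :> {set {set V}};
  faces_down : forall A B : {set V},
    A \subset B -> B \in faces -> A \in faces }.

Definition nbhd_faces (G : sgraph) : {set {set G}} :=
  [set A : {set G} | [exists v : G, forall a in A, edge v a]]%SET.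

Lemma nbhd_faces_down (G : sgraph) (A B : {set G}) :
  A \subset B -> B \in nbhd_faces G -> A \in nbhd_faces G.
Proof.
move=> /fintype.subsetP sAB; rewrite !inE => /existsP[v /forall_inP vB].
by apply/existsP; exists v; apply/forall_inP => a /sAB /vB.
Qed.

Definition neighborhood_complex (G : sgraph) : simplicial_complex G :=
  SimplicialComplex (@nbhd_faces_down G).

(* Barycentric coordinates in R^V with the product topology ({ptws V -> R});
   coerced to a type, this set carries the subspace topology. *)
Definition realization (R : realType) (V : finType)
    (K : simplicial_complex V) : set {ptws V -> R} :=
  [set x | [/\ forall v, 0 <= x v, \sum_(v : V) x v = 1
             & [set v | x v != 0]%SET \in faces K]].
Arguments realization R {V} K.

Definition sphere (R : realType) (d : nat) : set 'rV[R]_d.+1 :=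
  [set x | \sum_(i < d.+1) x ord0 i ^+ 2 = 1].
Arguments sphere R d : clear implicits.

Definition homeomorphic (X Y : topologicalType) : Prop :=
  exists (f : X -> Y) (g : Y -> X),
    [/\ continuous f, continuous g, cancel f g & cancel g f].

(* Continuity within X x [0, 1] disregards the values of h outside it. *)
Definition homotopic (R : realType) (X Y : topologicalType) (f g : X -> Y) :
    Prop :=
  exists h : X * R -> Y,
    [/\ {within [set: X] `*` `[0, 1], continuous h},
        forall x, h (x, 0) = f x & forall x, h (x, 1) = g x].

Definition homotopy_equivalent (R : realType) (X Y : topologicalType) : Prop :=
  exists (f : X -> Y) (g : Y -> X),
    [/\ continuous f, continuous g,
        homotopic R (g \o f) id & homotopic R (f \o g) id].

(* Main.v *)
Require Import Defs.
From mathcomp Require Import all_boot all_order all_algebra.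
From mathcomp Require Import all_classical all_reals topology normedtype.
From mathcomp Require Import realfun trigo.
From mathcomp Require Import zify ring lra.
Import numFieldNormedType.Exports.

(** An independent set of size n - 1 in CL_n misses exactly one rung i, and its
    signs alternate along the remaining path of rungs, so it is determined by i
    and one sign e.  For even n, two such sets are disjoint iff their signs e
    differ: H is complete bipartite and N(H) is a disjoint union of two simplices.

    For odd n, the labels i + n e in Z/2n, and likewise i + n (odd i (+) b) for
    the vertex (i, b) of CL_n, turn both graphs into the circulant graph joining k
    to k + n - 1, k + n and k + n + 1.  Its neighborhood complex is the strip of
    triangles {k - 1, k, k + 1} in Z/2n.  Sending vertex k to the point w^k of the
    circle, w = exp(i pi / n), extending affinely and normalizing maps the strip to
    the circle; the functions max(0, <z, w^k> - cos(pi / n)), normalized to sum 1,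
    map the circle back.  In the cone over a triangle only its own vertices have
    a nonzero function, so both composites are homotopic to the identity along
    (normalized) straight lines. *)

Set Implicit Arguments.
Unset Strict Implicit.
Unset Printing Implicit Defensive.

(** * Topology *)

Section Preliminaries.
Import Order.TTheory GRing.Theory Num.Theory.
Local Open Scope classical_set_scope.
Local Open Scope ring_scope.

Definition to_subset {T : Type} {A : set T} (x : T) (Ax : A x) : A :=
  exist _ x (mem_set Ax).

Lemma to_subsetK {T : Type} {A : set T} (x : T) (Ax : A x) :
  set_val (to_subset Ax) = x.
Proof. by []. Qed.

Lemma set_val_inj {T : Type} {A : set T} : injective (@set_val T A).
Proof. exact: val_inj. Qed.

Lemma continuous_to_subset {X Y : topologicalType} {A : set Y} (f : X -> A) :
  continuous (fun x => set_val (f x)) -> continuous f.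
Proof. exact: (@continuous_comp_initial _ _ _ (@set_val Y A)). Qed.

Lemma continuous_set_val {Y : topologicalType} {A : set Y} :
  continuous (@set_val Y A).
Proof. exact: initial_continuous. Qed.

Lemma continuous_to_ptws {X Y : topologicalType} {I : Type}
    (f : X -> {ptws I -> Y}) :
  (forall i, continuous (fun x => f x i)) -> continuous f.
Proof.
move=> cf x; apply/cvg_sup => i.
have := @continuous_comp_initial _ _ _ (fun f : I -> Y => f i) f (cf i).
exact.
Qed.

Lemma continuous_ptws_eval {Y : topologicalType} {I : eqType} (i : I) :
  continuous (fun f : {ptws I -> Y} => f i).
Proof. exact: (@proj_continuous I (fun=> Y)). Qed.

Lemma continuous_to_mx {X Y : topologicalType} {m n : nat}
    (f : X -> 'M[Y]_(m, n)) :
  (forall i j, continuous (fun x => f x i j)) -> continuous f.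
Proof.
move=> cf x U [P nP PU].
apply: (@filterS _ (nbhs x) _ (fun y => forall i j, P i j (f y i j))).
  by move=> y Py; apply: PU.
apply: filter_forall => i; apply: filter_forall => j.
exact: cf (nP i j).
Qed.

Lemma continuous_idfun {X : topologicalType} : continuous (@id X).
Proof. by move=> x; exact: cvg_id. Qed.

Lemma continuous_const {X Y : topologicalType} (y : Y) :
  continuous (fun _ : X => y).
Proof. by move=> x; exact: cvg_cst. Qed.

Section RealFunctions.
Context {R : realType} {X : topologicalType}.
Implicit Types f g : X -> R.

Lemma continuous_addr f g :
  continuous f -> continuous g -> continuous (fun x => f x + g x).
Proof. by move=> cf cg x; apply: cvgD; [exact: cf|exact: cg]. Qed.

Lemma continuous_subr f g :
  continuous f -> continuous g -> continuous (fun x => f x - g x).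
Proof. by move=> cf cg x; apply: cvgB; [exact: cf|exact: cg]. Qed.

Lemma continuous_mulr f g :
  continuous f -> continuous g -> continuous (fun x => f x * g x).
Proof. by move=> cf cg x; apply: cvgM; [exact: cf|exact: cg]. Qed.

Lemma continuous_divr f g : continuous f -> continuous g ->
  (forall x, g x != 0) -> continuous (fun x => f x / g x).
Proof.
move=> cf cg g0; apply: continuous_mulr => // x.
by apply: cvgV; [exact: g0|exact: cg].
Qed.

Lemma continuous_sumr (I : finType) (P : pred I) (f : I -> X -> R) :
  (forall i, continuous (f i)) -> continuous (fun x => \sum_(i | P i) f i x).
Proof.
move=> cf; apply: continuous_big => [|i _]; last exact: cf.
exact: add_continuous.
Qed.

Lemma continuous_maxr f g :
  continuous f -> continuous g -> continuous (fun x => Num.max (f x) (g x)).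
Proof. by move=> cf cg x; apply: continuous_max; [exact: cf|exact: cg]. Qed.

Lemma continuous_minr f g :
  continuous f -> continuous g -> continuous (fun x => Num.min (f x) (g x)).
Proof. by move=> cf cg x; apply: continuous_min; [exact: cf|exact: cg]. Qed.

Lemma continuous_sqrtr f : continuous f -> continuous (fun x => Num.sqrt (f x)).
Proof.
by move=> cf x; apply: continuous_comp; [exact: cf|exact: sqrt_continuous].
Qed.

End RealFunctions.

Lemma continuous_compf {X Y Z : topologicalType} (f : Y -> Z) (g : X -> Y) :
  continuous f -> continuous g -> continuous (fun x => f (g x)).
Proof. by move=> cf cg x; apply: continuous_comp; [exact: cg|exact: cf]. Qed.

Lemma continuous_fst {X Y : topologicalType} : continuous (@fst X Y).
Proof. by move=> x; exact: cvg_fst. Qed.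

Lemma continuous_snd {X Y : topologicalType} : continuous (@snd X Y).
Proof. by move=> x; exact: cvg_snd. Qed.

(* Precomposing with [clamp] makes a homotopy on [X * [0, 1]] continuous on all
   of [X * R]. *)
Definition clamp {R : realType} (t : R) : R := Num.max 0 (Num.min 1 t).

Lemma clamp_itv {R : realType} (t : R) : 0 <= clamp t <= 1.
Proof. by rewrite /clamp le_max lexx ge_max ler01 ge_min lexx. Qed.

Lemma clamp0 {R : realType} : clamp (0 : R) = 0.
Proof. by rewrite /clamp min_r ?ler01// max_l. Qed.

Lemma clamp1 {R : realType} : clamp (1 : R) = 1.
Proof. by rewrite /clamp min_l// max_r. Qed.

Lemma continuous_clamp {R : realType} : continuous (@clamp R).
Proof.
apply: continuous_maxr; first by move=> x; exact: cvg_cst.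
by apply: continuous_minr => x; [exact: cvg_cst|exact: cvg_id].
Qed.

(** An explicit formula stays in [A] only for times in [0, 1]; clamping the time yields the total
    map into [A] that [homotopic] asks for. *)
Lemma homotopic_in_subset (R : realType) (X Y : topologicalType) (A : set Y)
    (f g : X -> A) (h : X -> R -> Y) :
  continuous (fun p : X * R => h p.1 (clamp p.2)) ->
  (forall x t, 0 <= t <= 1 -> A (h x t)) ->
  (forall x, h x 0 = set_val (f x)) -> (forall x, h x 1 = set_val (g x)) ->
  homotopic R f g.
Proof.
move=> ch hA h0 h1.
exists (fun p => to_subset (hA p.1 _ (clamp_itv p.2))).
split=> [|x|x].
- exact/continuous_subspaceT/continuous_to_subset.
- by apply: set_val_inj; rewrite to_subsetK clamp0 h0.
- by apply: set_val_inj; rewrite to_subsetK clamp1 h1.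
Qed.

Lemma homotopic_refl {R : realType} {X Y : topologicalType} (f : X -> Y) :
  continuous f -> homotopic R f f.
Proof.
move=> cf; exists (fun p => f p.1); split=> //.
exact/continuous_subspaceT/continuous_compf/continuous_fst.
Qed.

End Preliminaries.

(** * Realizations of neighborhood complexes *)

Section Realization.
Import Order.TTheory GRing.Theory Num.Theory.
Local Open Scope classical_set_scope.
Local Open Scope ring_scope.

(** Faces are closed under subsets, so any face containing the support will do. *)
Lemma realizationI (R : realType) (V : finType) (K : simplicial_complex V)
    (A : {set V}) (x : {ptws V -> R}) :
  A \in faces K -> (forall v, 0 <= x v) -> \sum_v x v = 1 ->
  (forall v, x v != 0 -> v \in A) -> realization R K x.
Proof.
move=> KA x0 x1 xA; split=> //; apply: (faces_down _ KA).
by apply/fintype.subsetP => v; rewrite inE => /xA.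
Qed.

Lemma continuous_realization_coord (R : realType) (V : finType)
    (K : simplicial_complex V) (v : V) :
  continuous (fun x : realization R K => set_val x v).
Proof.
have cv := @continuous_ptws_eval R V v.
exact (continuous_compf cv (@continuous_set_val _ (realization R K))).
Qed.

(** If [f x] and [g x] lie in a common simplex, so does the segment between them, and the
    straight-line homotopy stays in the complex. *)
Lemma homotopic_realization (R : realType) (X : topologicalType) (V : finType)
    (K : simplicial_complex V) (f g : X -> realization R K) :
  continuous f -> continuous g ->
  (forall x, exists2 A, A \in faces K &
     forall v, set_val (f x) v != 0 \/ set_val (g x) v != 0 -> v \in A) ->
  homotopic R f g.
Proof.
move=> cf cg fgK.
pose h x t : {ptws V -> R} :=
  fun v => (1 - t) * set_val (f x) v + t * set_val (g x) v.
apply: (@homotopic_in_subset _ _ _ _ _ _ h) => [|x t /andP[t0 t1]|x|x].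
- apply: continuous_to_ptws => v; rewrite /h.
  have cc : continuous (fun p : X * R => clamp p.2).
    exact: (continuous_compf continuous_clamp continuous_snd).
  have cv k : continuous k -> continuous (fun p : X * R => set_val (k p.1 : realization R K) v).
    move=> ck; apply: (@continuous_compf _ _ _ (fun x => set_val (k x) v) fst).
      exact: (continuous_compf (@continuous_realization_coord _ _ _ v)).
    exact: continuous_fst.
  apply: continuous_addr; apply: continuous_mulr => //; try exact: cv.
  by apply: continuous_subr => //; exact: continuous_const.
- have [A KA fgA] := fgK x.
  have [f0 f1 _] := set_valP (f x); have [g0 g1 _] := set_valP (g x).
  apply: (realizationI KA) => [v||v].
  + by rewrite addr_ge0// mulr_ge0 ?f0 ?g0 ?subr_ge0.
  + by rewrite big_split/= -!mulr_sumr f1 g1 !mulr1 subrK.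
  + rewrite /h => hv; apply: fgA.
    have [fv|] := eqVneq (set_val (f x) v) 0; last by left.
    right; apply: contraNneq hv => gv; by rewrite fv gv !mulr0 addr0.
- by apply/funext => v; rewrite /h subr0 mul1r mul0r addr0.
- by apply/funext => v; rewrite /h subrr mul1r mul0r add0r.
Qed.

Lemma nbhd_faces_isom (G H : sgraph) (f : G -> H) (g : H -> G) :
  cancel f g -> cancel g f -> (forall x y, edge (f x) (f y) = edge x y) ->
  forall A, A \in faces (neighborhood_complex G) ->
    [set y | g y \in A]%SET \in faces (neighborhood_complex H).
Proof.
move=> fg gf fE A; rewrite !inE => /existsP[v /forall_inP vA].
apply/existsP; exists (f v); apply/forall_inP => a; rewrite inE => /vA.
by rewrite -fE gf.
Qed.

Lemma homeomorphic_neighborhood_complex (R : realType) (G H : sgraph) :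
  graph_isomorphic G H ->
  homeomorphic (realization R (neighborhood_complex G))
               (realization R (neighborhood_complex H)).
Proof.
move=> [f [[g fg gf] fE]].
have gE x y : edge (g x) (g y) = edge x y by rewrite -fE !gf.
(* Relabelling of coordinates along an isomorphism, for arbitrary graphs so as to serve both [f] and
   [g]. *)
have memp (G1 G2 : sgraph) (f1 : G1 -> G2) g1 : cancel f1 g1 -> cancel g1 f1 ->
    (forall x y, edge (f1 x) (f1 y) = edge x y) ->
    forall x : realization R (neighborhood_complex G1),
    realization R (neighborhood_complex G2) (fun v => set_val x (g1 v)).
  move=> fg1 gf1 fE1 x; have [x0 x1 xK] := set_valP x.
  apply: (realizationI (nbhd_faces_isom fg1 gf1 fE1 xK)) => [v||v].
  - exact: x0.
  - by rewrite -x1 (reindex g1)//; exists f1 => ? _.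
  - by rewrite !inE.
exists (fun x => to_subset ((memp _ _ _ _ fg gf fE x))).
exists (fun x => to_subset ((memp _ _ _ _ gf fg gE x))).
split.
- by apply/continuous_to_subset/continuous_to_ptws => v; exact: continuous_realization_coord.
- by apply/continuous_to_subset/continuous_to_ptws => v; exact: continuous_realization_coord.
- by move=> x; apply: set_val_inj; apply/funext => v; rewrite !to_subsetK fg.
- by move=> x; apply: set_val_inj; apply/funext => v; rewrite !to_subsetK gf.
Qed.

(** * Complete bipartite graphs and the 0-sphere *)

Section CompleteBipartite.
Context (R : realType) (G : sgraph) (col : G -> bool) (v0 v1 : G).
Hypotheses (col0 : col v0 = false) (col1 : col v1 = true).
Hypothesis edgeE : forall x y : G, edge x y = (col x != col y).
Let K := neighborhood_complex G.

(** Any vertex of the opposite colour is a common neighbor of the whole class. *)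
Lemma bipartite_face b : [set v | col v == b]%SET \in faces K.
Proof.
rewrite inE; apply/existsP; exists (if b then v0 else v1).
apply/forall_inP => a; rewrite inE edgeE => /eqP ->.
by case: b; rewrite ?col0 ?col1.
Qed.

Lemma bipartite_support (x : realization R K) :
  exists b, forall v, set_val x v != 0 -> col v = b.
Proof.
have [_ _] := set_valP x; rewrite inE => /existsP[w /forall_inP wx].
exists (~~ col w) => v xv; have := wx v; rewrite inE => /(_ xv).
by rewrite edgeE; case: (col w); case: (col v).
Qed.

(** Its only values are 1 and -1, by the colour of the support; the linear formula makes continuity
    immediate. *)
Definition sign_coord (x : realization R K) : R :=
  \sum_(v | col v) set_val x v - \sum_(v | ~~ col v) set_val x v.

Lemma sign_coordE x b : (forall v, set_val x v != 0 -> col v = b) ->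
  sign_coord x = (-1) ^+ (~~ b).
Proof.
move=> xb; have [_ x1 _] := set_valP x.
have z (P : pred G) : (forall v, P v -> col v != b) ->
    \sum_(v | P v) set_val x v = 0.
  move=> Pb; apply: big1 => v /Pb vb; apply/eqP; apply: contraNT vb => /xb ->.
  by [].
rewrite /sign_coord; move: x1; rewrite (bigID col)/=.
case: b xb z => xb z.
- by rewrite (z (fun v => ~~ col v)) ?subr0 ?addr0// => v; case: (col v).
- by rewrite (z col) ?sub0r ?add0r ?expr1 => [->|v] //; case: (col v).
Qed.

Lemma sign_coord_sphere x : sphere R 0 (const_mx (sign_coord x)).
Proof.
have [b /sign_coordE xE] := bipartite_support x.
by rewrite /sphere/= big_ord1 mxE xE; case: b {xE} => /=; rewrite ?sqrrN expr1n.
Qed.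

Lemma sphere0P (z : sphere R 0) :
  set_val z ord0 ord0 = 1 \/ set_val z ord0 ord0 = -1.
Proof.
have := set_valP z; rewrite /sphere/= big_ord1 => /eqP; rewrite sqrf_eq1.
by move=> /orP[] /eqP; [left|right].
Qed.

(** Affine in [z] for the sake of continuity; the two points of the sphere give the vertices [v1]
    and [v0]. *)
Definition sphere0_vertex (z : sphere R 0) : {ptws G -> R} := fun v =>
  (1 + set_val z ord0 ord0) / 2 * (v == v1)%:R +
  (1 - set_val z ord0 ord0) / 2 * (v == v0)%:R.

Lemma sphere0_vertexE (z : sphere R 0) b : set_val z ord0 ord0 = (-1) ^+ (~~ b) ->
  forall v, sphere0_vertex z v = (v == if b then v1 else v0)%:R.
Proof.
move=> zE v; rewrite /sphere0_vertex zE; case: b {zE} => /=; lra.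
Qed.

Lemma sphere0_signP (z : sphere R 0) :
  exists b : bool, set_val z ord0 ord0 = (-1) ^+ (~~ b).
Proof. by have [->|->] := sphere0P z; [exists true|exists false]. Qed.

Lemma sphere0_vertex_realization z : realization R K (sphere0_vertex z).
Proof.
have [b /sphere0_vertexE gE] := sphere0_signP z.
apply: (realizationI (bipartite_face b)) => [v||v].
- by rewrite gE.
- under eq_bigr do rewrite gE.
  rewrite (bigD1 (if b then v1 else v0))//= eqxx big1 ?addr0// => i.
  by move=> /negPf ->.
- rewrite gE inE; have [->|_] := eqVneq v; last by rewrite eqxx.
  by case: (b); rewrite ?col0 ?col1.
Qed.

(** Each simplex collapses to its sign, and each sign returns to a vertex of that simplex. One
    composite moves points only within their simplex; the other is the identity. *)
Lemma homotopy_equivalent_bipartite :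
  homotopy_equivalent R (realization R K) (sphere R 0).
Proof.
pose f x : sphere R 0 := to_subset ((sign_coord_sphere x)).
pose g z : realization R K := to_subset ((sphere0_vertex_realization z)).
have cf : continuous f.
  apply/continuous_to_subset/continuous_to_mx => i j.
  rewrite (_ : (fun _ => _) = sign_coord); last first.
    by apply/funext => x; rewrite to_subsetK mxE.
  have cs (P : pred G) :
      continuous (fun x : realization R K => \sum_(v | P v) set_val x v).
    exact (continuous_sumr (P:=P) (@continuous_realization_coord R G K)).
  exact: (continuous_subr (cs col) (cs (predC col))).
have cg : continuous g.
  apply/continuous_to_subset/continuous_to_ptws => v.
  have cz : continuous (fun z : sphere R 0 => set_val z ord0 ord0).
    exact: (continuous_compf (@coord_continuous _ _ _ _ _) continuous_set_val).
  have cc (c : R) : continuous (fun _ : sphere R 0 => c).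
    exact: continuous_const.
  rewrite /= /sphere0_vertex.
  apply: continuous_addr; do 2 apply: continuous_mulr => //.
    exact: continuous_addr.
  exact: continuous_subr.
exists f, g; split=> //.
- apply: homotopic_realization => [||x].
  + exact: (continuous_compf cg cf).
  + exact: continuous_idfun.
  + have [b xb] := bipartite_support x; exists [set v | col v == b]%SET.
      exact: bipartite_face.
    move=> v; rewrite inE => -[|/xb ->//]; rewrite to_subsetK.
    rewrite (@sphere0_vertexE _ b); last first.
      by rewrite to_subsetK mxE (@sign_coordE _ b).
    have [->|_] := eqVneq v; last by rewrite eqxx.
    by case: (b); rewrite ?col0 ?col1.
- suff -> : f \o g = id by exact: (homotopic_refl continuous_idfun).
  apply/funext => z; apply: set_val_inj; apply/matrixP => i j.
  have [b zb] := sphere0_signP z; have gE := sphere0_vertexE zb.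
  rewrite mxE (@sign_coordE _ b); first by rewrite -zb !ord1.
  move=> v; rewrite to_subsetK gE; have [->|_] := eqVneq v; last by rewrite eqxx.
  by case: (b); rewrite ?col0 ?col1.
Qed.

End CompleteBipartite.
End Realization.

(** * Plane trigonometry *)

Section UnitVectors.
Import Order.TTheory GRing.Theory Num.Theory.
Local Open Scope classical_set_scope.
Local Open Scope ring_scope.
Context {R : realType}.

Definition norm2 (a b : R) : R := Num.sqrt (a ^+ 2 + b ^+ 2).

Definition unit_vector (a b : R) : 'rV[R]_2 :=
  \row_(i < 2) ((if i == ord0 then a else b) / norm2 a b).

Lemma norm2_gt0 a b : 0 < a ^+ 2 + b ^+ 2 -> 0 < norm2 a b.
Proof. by rewrite sqrtr_gt0. Qed.

Lemma unit_vector_sphere a b :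
  0 < a ^+ 2 + b ^+ 2 -> sphere R 1 (unit_vector a b).
Proof.
move=> ab; have N0 := norm2_gt0 ab.
rewrite /sphere/= big_ord_recl big_ord1 !mxE/= !expr_div_n -mulrDl.
by rewrite /norm2 sqr_sqrtr ?ltW// divff// gt_eqF.
Qed.

Lemma continuous_unit_vector (X : topologicalType) (a b : X -> R) :
  continuous a -> continuous b -> (forall x, 0 < a x ^+ 2 + b x ^+ 2) ->
  continuous (fun x => unit_vector (a x) (b x)).
Proof.
move=> ca cb ab; apply: continuous_to_mx => i j.
rewrite (_ : (fun x => _) = fun x => (if j == ord0 then a x else b x) /
  norm2 (a x) (b x)); last by apply/funext => x; rewrite mxE.
apply: continuous_divr => [|| x].
- by case: eqP.
- rewrite /norm2; apply: continuous_sqrtr.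
  by apply: continuous_addr; apply: continuous_mulr.
- by rewrite gt_eqF ?norm2_gt0.
Qed.

Lemma sphere1_sumsq (z : sphere R 1) :
  (set_val z ord0 ord0) ^+ 2 + (set_val z ord0 ord_max) ^+ 2 = 1.
Proof.
have := set_valP z; rewrite /sphere/= big_ord_recl big_ord1.
by rewrite (_ : lift ord0 ord0 = ord_max)//; exact: val_inj.
Qed.

Lemma unit_vector_id (z : sphere R 1) :
  unit_vector (set_val z ord0 ord0) (set_val z ord0 ord_max) = set_val z.
Proof.
apply/rowP => i; rewrite mxE /norm2 sphere1_sumsq sqrtr1 divr1.
by case: eqP => [->//|/eqP i0]; congr (set_val z _ _); apply: val_inj; case: i i0 => -[|[]].
Qed.

Lemma continuous_sphere1_coord i :
  continuous (fun z : sphere R 1 => set_val z ord0 i).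
Proof.
exact: (continuous_compf (@coord_continuous _ _ _ _ _) continuous_set_val).
Qed.

End UnitVectors.

Section PlaneInequalities.
Import Order.TTheory GRing.Theory Num.Theory.
Local Open Scope ring_scope.
Context {R : realType}.

(* For [0 <= q], write [(p, q)] as a combination of [(1, 0)] and [(c, s)] with
   nonnegative coefficients and compare with its product with [(c, s)]. *)
Lemma cone_far_le (c s p q C S : R) : 0 < c -> 0 < s -> c ^+ 2 + s ^+ 2 = 1 ->
  p ^+ 2 + q ^+ 2 = 1 -> 0 <= s * p - c * q -> 0 <= s * p + c * q ->
  C <= c ^+ 2 -> c * C + s * S <= c -> c * C - s * S <= c -> p * C + q * S <= c.
Proof.
move=> c0 s0 cs pq h1 h2 C2 CS1 CS2.
(* Expand the squared distances from [(p, q)] to the unit vectors [(c, s)] and [(c, - s)]. *)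
have pcqs : p * c + q * s <= 1 /\ p * c - q * s <= 1.
  have := sqr_ge0 (p - c); have := sqr_ge0 (q - s); have := sqr_ge0 (q + s); nra.
rewrite -(ler_pM2l s0).
(* The two cases are mirror images under negating both [q] and [S]. *)
have [q0|q0] := leP 0 q.
- have -> : s * (p * C + q * S) = (s * p - c * q) * C + q * (c * C + s * S) by ring.
  apply: (@le_trans _ _ ((s * p - c * q) * c ^+ 2 + q * c)).
    by apply: lerD; apply: ler_wpM2l.
  have -> : (s * p - c * q) * c ^+ 2 + q * c = s * c * (p * c + q * s).
    by rewrite -[q * c]mulr1 -cs; ring.
  by apply: ler_piMr; [apply: mulr_ge0; exact: ltW|case: pcqs].
- have -> : s * (p * C + q * S) = (s * p + c * q) * C + (- q) * (c * C - s * S) by ring.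
  apply: (@le_trans _ _ ((s * p + c * q) * c ^+ 2 + (- q) * c)).
    by apply: lerD; apply: ler_wpM2l => //; rewrite oppr_ge0 ltW.
  have -> : (s * p + c * q) * c ^+ 2 + (- q) * c = s * c * (p * c - q * s).
    by rewrite -[- q * c]mulr1 -cs; ring.
  by apply: ler_piMr; [apply: mulr_ge0; exact: ltW|case: pcqs].
Qed.

(** The unit vector [(p, q)] is at least as close to [(1, 0)] as to [(c, s)] and [(c, - s)], so its
    angle to [(1, 0)] is at most half the step between these directions. *)
Lemma proj_local_max_gt (c s p q : R) :
  0 < c -> c < 1 -> 0 < s -> c ^+ 2 + s ^+ 2 = 1 -> p ^+ 2 + q ^+ 2 = 1 ->
  p * c + q * s <= p -> p * c - q * s <= p ->
  [/\ c < p, 0 <= s * p - c * q & 0 <= s * p + c * q].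
Proof.
move=> c0 c1 s0 cs pq h1 h2.
have p0 : 0 <= p by nra.
have psq : 0 <= p * (1 - c) by apply: mulr_ge0 => //; lra.
(* Multiply the two hypotheses and cancel [1 - c], which divides [s ^+ 2]. *)
have q2 : q ^+ 2 * (1 + c) <= p ^+ 2 * (1 - c).
  have h : 0 <= (p * (1 - c) - q * s) * (p * (1 - c) + q * s).
    by apply: mulr_ge0; lra.
  rewrite -(@ler_pM2l _ (1 - c)) ?subr_gt0//.
  have -> : (1 - c) * (q ^+ 2 * (1 + c)) = q ^+ 2 * s ^+ 2.
    by rewrite (_ : s ^+ 2 = 1 - c ^+ 2); [ring|lra].
  by rewrite -subr_ge0 (_ : _ - _ = (p * (1 - c) - q * s) * (p * (1 - c) + q * s)) //; ring.
have s2 : s ^+ 2 = (1 - c) * (1 + c).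
  by transitivity (1 - c ^+ 2); [rewrite -cs addrAC subrr add0r|ring].
split.
(* With [pq], the bound [q2] gives 2 p^2 >= 1 + c > 2 c^2. *)
- by rewrite ltNge; apply/negP => pc; nra.
(* Multiplied by [s], the claim is the sum of [h] and [psq]. *)
- have h : 0 <= c * (p * (1 - c) - q * s) by apply: mulr_ge0; lra.
  rewrite -(pmulr_rge0 _ s0) mulrBr mulrA -expr2 s2; lra.
- have h : 0 <= c * (p * (1 - c) + q * s) by apply: mulr_ge0; lra.
  rewrite -(pmulr_rge0 _ s0) mulrDr mulrA -expr2 s2; lra.
Qed.

End PlaneInequalities.

Section Trigonometry.
Import Order.TTheory GRing.Theory Num.Theory.
Local Open Scope ring_scope.
Context {R : realType} (n : nat).
Hypothesis n3 : (3 <= n)%N.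

Let alpha : R := pi / n%:R.
Let c : R := cos alpha.
Let s : R := sin alpha.

Let n0 : 0 < n%:R :> R. Proof. by rewrite ltr0n; lia. Qed.

Let alphan : alpha * n%:R = pi.
Proof. by rewrite /alpha divfK ?gt_eqF. Qed.

Let alpha_gt0 : 0 < alpha. Proof. by rewrite divr_gt0 ?pi_gt0. Qed.

Let alpha_lt : alpha < pi / 2.
Proof.
have : 3%:R <= n%:R :> R by rewrite ler_nat.
have := alphan; have := alpha_gt0; have := @pi_gt0 R; nra.
Qed.

Lemma cos_alpha_gt0 : 0 < c.
Proof. by apply: cos_gt0_pihalf; have := alpha_lt; have := alpha_gt0; lra. Qed.

Lemma sin_alpha_gt0 : 0 < s.
Proof. by apply: sin_gt0_pihalf; have := alpha_lt; have := alpha_gt0; lra. Qed.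

Lemma cos2Dsin2_alpha : c ^+ 2 + s ^+ 2 = 1.
Proof. exact: cos2Dsin2. Qed.

Lemma cos_alpha_lt1 : c < 1.
Proof. have := cos2Dsin2_alpha; have := sin_alpha_gt0; have := cos_alpha_gt0; nra. Qed.

Lemma ler_cos (x y : R) : 0 <= x -> x <= y -> y <= pi -> cos y <= cos x.
Proof.
move=> x0; rewrite le_eqVlt => /orP[/eqP ->//|xy] ypi.
by apply/ltW; rewrite ltr_cos// in_itv/=; apply/andP; split; lra.
Qed.

Lemma cos_reflect (m : nat) : (m <= n.*2)%N ->
  cos (alpha * m%:R) = cos (alpha * (n.*2 - m)%:R).
Proof.
move=> mn; rewrite natrB// -mul2n natrM -cosN mulrBr.
by rewrite (_ : _ - _ = - (alpha * m%:R) + pi *+ 2) ?cosD2pi// -alphan; ring.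
Qed.

(** Cosine decreases on [0, pi], which settles [m <= n]; [cos_reflect] folds back the other half of
    the turn. *)
Lemma cos_mult_le (d m : nat) : (d <= m)%N -> (m <= n.*2 - d)%N ->
  cos (alpha * m%:R) <= cos (alpha * d%:R).
Proof.
wlog mn : m / (m <= n)%N => [hw dm md|dm _].
  have [/hw->//|nm] := leqP m n.
  by rewrite cos_reflect; [apply: hw|]; lia.
apply: ler_cos.
- by rewrite mulr_ge0// ltW.
- by rewrite ler_pM2l// ler_nat.
- by rewrite -alphan ler_pM2l// ler_nat.
Qed.

(* For [i, j < 2n]: [i] and [j] differ by at most one modulo [2n]. *)
Definition cyc_near (i j : nat) : bool :=
  ((i - j) + (j - i) <= 1)%N || (n.*2.-1 <= (i - j) + (j - i))%N.

Lemma near_trig (j k : nat) : (j < n.*2)%N -> (k < n.*2)%N -> cyc_near j k ->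
  let x := alpha * j%:R - alpha * k%:R in
  [\/ cos x = 1 /\ sin x = 0, cos x = c /\ sin x = s | cos x = c /\ sin x = - s].
Proof.
move=> jn kn jk /=.
have pi2 : alpha * n.*2%:R = pi *+ 2 by rewrite -mul2n natrM mulrCA alphan mulr2n; ring.
(* The last two cases are the wrap-around between 2n - 1 and 0. *)
have : j = k \/ [\/ j = k.+1, k = j.+1, (j.+1 = k + n.*2)%N | (k.+1 = j + n.*2)%N].
  move: jk; rewrite /cyc_near => /orP[] h.
  - have [?|?|?] := ltngtP j k; [right; constructor 2|right; constructor 1|left]; lia.
  - have [?|?] := leqP j k; right; [constructor 4|constructor 3]; lia.
case=> [jkE|[] jkE].
- by constructor 1; rewrite jkE subrr cos0 sin0.
- constructor 2; rewrite jkE -natr1 (_ : _ - _ = alpha)//; ring.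
- by constructor 3; rewrite jkE -natr1 (_ : _ - _ = - alpha) ?cosN ?sinN//; ring.
- constructor 3; have -> : alpha * j%:R - alpha * k%:R = - alpha + pi *+ 2.
    move/(congr1 (fun m => alpha * m%:R)) : jkE; rewrite -natr1 natrD !mulrDr pi2; lra.
  by rewrite cosD2pi sinD2pi cosN sinN.
- constructor 2; have -> : alpha * j%:R - alpha * k%:R = - (- alpha + pi *+ 2).
    move/(congr1 (fun m => alpha * m%:R)) : jkE; rewrite -natr1 natrD !mulrDr pi2; lra.
  by rewrite cosN sinN cosD2pi sinD2pi cosN sinN opprK.
Qed.

(** These are the bounds that [cone_far_le] needs. Up to sign, x is m steps with 2 <= m <= 2n - 2,
    so its cosine is at most cos(2 alpha) = c^2 - s^2. The other two expressions are cosines of m -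
    1 and m + 1 steps. *)
Lemma far_trig (j k : nat) : (j < n.*2)%N -> (k < n.*2)%N -> ~~ cyc_near j k ->
  let x := alpha * j%:R - alpha * k%:R in
  [/\ cos x <= c ^+ 2, c * cos x + s * sin x <= c & c * cos x - s * sin x <= c].
Proof.
move=> jn kn jk /=.
wlog kj : j k jn kn jk / (k <= j)%N => [hw|].
  have [/(hw _ _ jn kn jk)//|/ltnW] := leqP k j.
  have kj : ~~ cyc_near k j by move: jk; rewrite /cyc_near addnC.
  move=> /(hw _ _ kn jn kj)[h1 h2 h3].
  by rewrite -opprB cosN sinN mulrN opprK.
have [m mE] : exists m, j = (k + m)%N by exists (j - k)%N; lia.
have [m2 mn] : (2 <= m)%N /\ (m <= n.*2 - 2)%N.
  by move: jk; rewrite /cyc_near; lia.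
have c1 : c = cos (alpha * 1%:R) by rewrite mulr1.
have -> : alpha * j%:R - alpha * k%:R = alpha * m%:R by rewrite mE natrD; ring.
split.
- apply: le_trans (cos_mult_le m2 mn) _.
  rewrite mulr_natr cos_mulr2n; have := cos2Dsin2_alpha; rewrite -/c.
  have := sqr_ge0 s; lra.
- rewrite -cosB [leRHS]c1.
  rewrite (_ : alpha - _ = - (alpha * m.-1%:R)) ?cosN.
    by apply: cos_mult_le; lia.
  have -> : m%:R = m.-1%:R + 1 :> R by rewrite natr1; congr _%:R; lia.
  ring.
- rewrite -cosD [leRHS]c1.
  rewrite (_ : alpha + _ = alpha * m.+1%:R).
    by apply: cos_mult_le; lia.
  by rewrite -natr1; ring.
Qed.

(** [proj_on k] and [proj_orth k] are the coordinates in the orthonormal frame rotated by k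
    steps. *)
Definition proj_on (k : nat) (x y : R) : R :=
  x * cos (alpha * k%:R) + y * sin (alpha * k%:R).
Definition proj_orth (k : nat) (x y : R) : R :=
  y * cos (alpha * k%:R) - x * sin (alpha * k%:R).

Lemma proj_onE j k x y : proj_on j x y =
  proj_on k x y * cos (alpha * j%:R - alpha * k%:R) +
  proj_orth k x y * sin (alpha * j%:R - alpha * k%:R).
Proof.
rewrite /proj_on /proj_orth.
have := esym (subrK (alpha * k%:R) (alpha * j%:R)).
by move: (_ - _) => d ->; rewrite cosD sinD; ring.
Qed.

Lemma proj_sumsq k x y :
  proj_on k x y ^+ 2 + proj_orth k x y ^+ 2 = x ^+ 2 + y ^+ 2.
Proof.
have := cos2Dsin2 (alpha * k%:R); rewrite /proj_on /proj_orth.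
by move: (cos _) (sin _) => C S CS; rewrite -[RHS]mulr1 -CS; ring.
Qed.

(* The cone spanned by the directions [k - 1] and [k + 1]. *)
Definition in_cone (k : nat) (x y : R) : Prop :=
  0 <= s * proj_on k x y - c * proj_orth k x y /\
  0 <= s * proj_on k x y + c * proj_orth k x y.

Lemma in_coneZ k r x y : 0 <= r -> in_cone k x y -> in_cone k (x * r) (y * r).
Proof.
by move=> r0 [h1 h2]; split; move: (mulr_ge0 h1 r0) (mulr_ge0 h2 r0);
  rewrite /proj_on /proj_orth; lra.
Qed.

(** This is [cone_far_le] read in the frame of direction [k]. *)
Lemma in_cone_far j k x y : (j < n.*2)%N -> (k < n.*2)%N -> ~~ cyc_near j k ->
  in_cone k x y -> x ^+ 2 + y ^+ 2 = 1 -> proj_on j x y <= c.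
Proof.
move=> jn kn /(far_trig jn kn)/= [C2 CS1 CS2].
rewrite /in_cone -(proj_sumsq k) (proj_onE j k) => -[h1 h2] pq.
apply: cone_far_le C2 CS1 CS2 => //.
- exact: cos_alpha_gt0.
- exact: sin_alpha_gt0.
- exact: cos2Dsin2_alpha.
Qed.

End Trigonometry.

(** * The strip of triangles and the circle *)

Section CyclicStrip.
Import Order.TTheory GRing.Theory Num.Theory.
Local Open Scope classical_set_scope.
Local Open Scope ring_scope.
Context (R : realType) (n : nat) (n3 : (3 <= n)%N).
Context (V : finType) (K : simplicial_complex V) (idx : V -> nat).
Hypothesis idx_lt : forall v, (idx v < n.*2)%N.
Hypothesis idx_surj : forall k, (k < n.*2)%N -> exists v, idx v = k.
Hypothesis stripP : forall A : {set V}, A \in faces K <->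
  exists2 k, (k < n.*2)%N & forall v, v \in A -> cyc_near n (idx v) k.

Let alpha : R := pi / n%:R.
Let c : R := cos alpha.
Let s : R := sin alpha.
Let c0 : 0 < c := cos_alpha_gt0 n3.
Let c1 : c < 1 := cos_alpha_lt1 n3.
Let s0 : 0 < s := sin_alpha_gt0 n3.
Let cs : c ^+ 2 + s ^+ 2 = 1 := cos2Dsin2_alpha n.

Local Notation proj := (@proj_on R n).
Local Notation cone := (@in_cone R n).

(* The vertex whose direction is closest to [(x, y)] works. *)
Lemma exists_in_cone (x y : R) : x ^+ 2 + y ^+ 2 = 1 ->
  exists2 v, c < proj (idx v) x y & cone (idx v) x y.
Proof.
move=> xy; have [v0 _] : exists v, idx v = 0 by apply: idx_surj; lia.
have [v _ vmax] := arg_maxP (fun v => proj (idx v) x y) (erefl (predT v0)).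
have succ (j k : nat) : (j < n.*2)%N -> (k < n.*2)%N ->
    (j = k.+1 \/ (j = 0 /\ k.+1 = n.*2)) ->
    cos (alpha * j%:R - alpha * k%:R) = c /\ sin (alpha * j%:R - alpha * k%:R) = s.
  move=> jn kn; case=> [->|[-> kE]].
    by rewrite -natr1 (_ : _ - _ = alpha)//; ring.
  rewrite (_ : _ - _ = - (- alpha + pi *+ 2)).
    by rewrite cosN sinN cosD2pi sinD2pi cosN sinN opprK.
  have -> : k%:R = n.*2%:R - 1 :> R by rewrite -kE -natr1; ring.
  have nn0 : n%:R != 0 :> R by rewrite pnatr_eq0; lia.
  by rewrite -mul2n natrM /alpha; field.
(* [w1] and [w2] follow and precede [v] in the cyclic order; maximality of [v] against these two
   feeds [proj_local_max_gt]. *)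
have [w1 w1E] : exists w, idx w = (if (idx v).+1 == n.*2 then 0 else (idx v).+1).
  by apply: idx_surj; case: eqP; have := idx_lt v; lia.
have [w2 w2E] : exists w, idx w = (if idx v == 0 then n.*2.-1 else (idx v).-1).
  by apply: idx_surj; case: eqP; have := idx_lt v; lia.
have [C1 S1] : cos (alpha * (idx w1)%:R - alpha * (idx v)%:R) = c /\
    sin (alpha * (idx w1)%:R - alpha * (idx v)%:R) = s.
  by apply: succ => //; rewrite w1E; case: eqP; have := idx_lt v; lia.
have [C2 S2] : cos (alpha * (idx v)%:R - alpha * (idx w2)%:R) = c /\
    sin (alpha * (idx v)%:R - alpha * (idx w2)%:R) = s.
  by apply: succ => //; rewrite w2E; case: eqP; have := idx_lt v; lia.
have h1 : proj (idx w1) x y <= proj (idx v) x y := vmax w1 isT.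
have h2 : proj (idx w2) x y <= proj (idx v) x y := vmax w2 isT.
move: h1 h2; rewrite (proj_onE n (idx w1) (idx v)) (proj_onE n (idx w2) (idx v)).
rewrite -/alpha C1 S1 -[_ * (idx w2)%:R - _]opprB cosN sinN C2 S2 mulrN => h1 h2.
have pq := proj_sumsq n (idx v) x y; rewrite xy in pq.
by have [h3 h4 h5] := proj_local_max_gt c0 c1 s0 cs pq h1 h2; exists v.
Qed.

(** The two coordinates of the affine extension of the map sending each vertex to its unit
    vector. *)
Let bary1 (x : {ptws V -> R}) : R := \sum_v x v * cos (alpha * (idx v)%:R).
Let bary2 (x : {ptws V -> R}) : R := \sum_v x v * sin (alpha * (idx v)%:R).

Lemma bary_proj x a b :
  bary1 x * a + bary2 x * b = \sum_v x v * proj (idx v) a b.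
Proof.
rewrite /bary1 /bary2 !mulr_suml -big_split/=; apply: eq_bigr => v _.
by rewrite /proj_on -/alpha; ring.
Qed.

Section OnePoint.
Context (x : {ptws V -> R}) (k : nat).
Hypotheses (x_ge0 : forall v, 0 <= x v) (x_sum : \sum_v x v = 1).
Hypotheses (k_lt : (k < n.*2)%N).
Hypothesis x_near : forall v, x v != 0 -> cyc_near n (idx v) k.

(** Each vertex within one step of [k] has projection at least [c], hence so has their weighted
    mean. In particular the mean is not 0 and can be normalized. *)
Lemma bary_proj_on : c <= proj k (bary1 x) (bary2 x).
Proof.
have -> : c = \sum_v x v * c by rewrite -mulr_suml x_sum mul1r.
rewrite /proj_on -/alpha bary_proj; apply: ler_sum => v _.
have [->|/x_near vk] := eqVneq (x v) 0; first by rewrite !mul0r.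
apply: ler_wpM2l => //; rewrite /proj_on -/alpha.
rewrite [leRHS](_ : _ = cos (alpha * (idx v)%:R - alpha * k%:R)); last first.
  by rewrite cosB; ring.
by have [] := near_trig (R := R) n3 (idx_lt v) k_lt vk => -[-> _] //; exact: ltW.
Qed.

Lemma bary_sumsq_gt0 : 0 < bary1 x ^+ 2 + bary2 x ^+ 2.
Proof.
rewrite -(proj_sumsq n k); apply: ltr_wpDr; first exact: sqr_ge0.
by rewrite exprn_gt0// (lt_le_trans c0 bary_proj_on).
Qed.

(** In the frame of [k] the vertices of the triangle are (1, 0), (c, s) and (c, -s); all lie in the
    cone, which is convex. *)
Lemma bary_in_cone : cone k (bary1 x) (bary2 x).
Proof.
have onE : proj k (bary1 x) (bary2 x) =
    \sum_v x v * cos (alpha * (idx v)%:R - alpha * k%:R).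
  rewrite /proj_on -/alpha bary_proj; apply: eq_bigr => v _.
  by rewrite /proj_on cosB -/alpha; ring.
have orthE : proj_orth n k (bary1 x) (bary2 x) =
    \sum_v x v * sin (alpha * (idx v)%:R - alpha * k%:R).
  rewrite /proj_orth -/alpha addrC -mulrN bary_proj; apply: eq_bigr => v _.
  by rewrite /proj_on sinB -/alpha; ring.
have sc0 : 0 <= s * c by rewrite mulr_ge0// ltW.
rewrite /in_cone onE orthE !mulr_sumr -sumrB -big_split/=.
split; apply: sumr_ge0 => v _.
- have [->|/x_near vk] := eqVneq (x v) 0; first by rewrite !mul0r !mulr0 subr0.
  rewrite ![_ * (x v * _)]mulrCA -mulrBr mulr_ge0//.
  have s0' := ltW s0.
  by have [] := near_trig (R := R) n3 (idx_lt v) k_lt vk => -[-> ->]; rewrite -/alpha -/c -/s; lra.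
- have [->|/x_near vk] := eqVneq (x v) 0; first by rewrite !mul0r !mulr0 addr0.
  rewrite ![_ * (x v * _)]mulrCA -mulrDr mulr_ge0//.
  have s0' := ltW s0.
  by have [] := near_trig (R := R) n3 (idx_lt v) k_lt vk => -[-> ->]; rewrite -/alpha -/c -/s; lra.
Qed.

End OnePoint.

Lemma strip_support (x : realization R K) :
  exists2 k, (k < n.*2)%N & forall v, set_val x v != 0 -> cyc_near n (idx v) k.
Proof.
have [_ _ /stripP[k kn xk]] := set_valP x; exists k => // v xv.
by apply: xk; rewrite inE.
Qed.

Lemma strip_face k : (k < n.*2)%N ->
  [set v | cyc_near n (idx v) k]%SET \in faces K.
Proof. by move=> kn; apply/stripP; exists k => // v; rewrite inE. Qed.

Lemma bary_gt0 (x : realization R K) :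
  0 < bary1 (set_val x) ^+ 2 + bary2 (set_val x) ^+ 2.
Proof.
have [x0 x1 _] := set_valP x; have [k kn xk] := strip_support x.
exact: bary_sumsq_gt0 xk.
Qed.

Let to_circle (x : realization R K) : sphere R 1 :=
  to_subset (unit_vector_sphere (bary_gt0 x)).

(** Nonzero exactly on the open arc of points less than one step away from the direction of [v]. *)
Let tent (z : sphere R 1) (v : V) : R :=
  Num.max 0 (proj (idx v) (set_val z ord0 ord0) (set_val z ord0 ord_max) - c).

Lemma tent_ge0 z v : 0 <= tent z v.
Proof. by rewrite le_max lexx. Qed.

Lemma tent_neq0 z v : tent z v != 0 ->
  c < proj (idx v) (set_val z ord0 ord0) (set_val z ord0 ord_max).
Proof.
rewrite -subr_gt0 ltNge; apply: contraNN => h.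
by rewrite /tent max_l.
Qed.

(** The arcs cover the circle by [exists_in_cone]. *)
Lemma tent_sum_gt0 z : 0 < \sum_v tent z v.
Proof.
have [v vc _] := exists_in_cone (sphere1_sumsq z).
rewrite (bigD1 v)//=; apply: ltr_wpDr.
  by apply: sumr_ge0 => w _; exact: tent_ge0.
by rewrite lt_max subr_gt0 vc orbT.
Qed.

Let of_circle_fun (z : sphere R 1) : {ptws V -> R} :=
  fun v => tent z v / \sum_w tent z w.

Lemma of_circle_neq0 z v : of_circle_fun z v != 0 ->
  c < proj (idx v) (set_val z ord0 ord0) (set_val z ord0 ord_max).
Proof. by rewrite mulf_eq0 negb_or => /andP[/tent_neq0]. Qed.

Lemma of_circle_ge0 z v : 0 <= of_circle_fun z v.
Proof. by rewrite divr_ge0 ?tent_ge0// ltW// tent_sum_gt0. Qed.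

Lemma of_circle_sum z : \sum_v of_circle_fun z v = 1.
Proof. by rewrite -mulr_suml divff// gt_eqF// tent_sum_gt0. Qed.

Lemma of_circle_near (z : sphere R 1) k v : (k < n.*2)%N ->
  cone k (set_val z ord0 ord0) (set_val z ord0 ord_max) ->
  of_circle_fun z v != 0 -> cyc_near n (idx v) k.
Proof.
move=> kn zk /of_circle_neq0; rewrite ltNge; apply: contraNT => vk.
exact: (in_cone_far n3 (idx_lt v) kn vk zk (sphere1_sumsq z)).
Qed.

Lemma of_circle_realization z : realization R K (of_circle_fun z).
Proof.
have [v _ zv] := exists_in_cone (sphere1_sumsq z).
apply: (realizationI (strip_face (idx_lt v))) => [w||w wz].
- exact: of_circle_ge0.
- exact: of_circle_sum.
- by rewrite inE; exact: (of_circle_near (idx_lt v) zv wz).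
Qed.

Let of_circle (z : sphere R 1) : realization R K :=
  to_subset (of_circle_realization z).

Lemma continuous_bary1 : continuous (fun x : realization R K => bary1 (set_val x)).
Proof.
have cx v : continuous (fun x : realization R K =>
    set_val x v * cos (alpha * (idx v)%:R)).
  by apply: continuous_mulr;
    [exact: continuous_realization_coord|exact: continuous_const].
exact (continuous_sumr (P := xpredT) cx).
Qed.

Lemma continuous_bary2 : continuous (fun x : realization R K => bary2 (set_val x)).
Proof.
have cx v : continuous (fun x : realization R K =>
    set_val x v * sin (alpha * (idx v)%:R)).
  by apply: continuous_mulr;
    [exact: continuous_realization_coord|exact: continuous_const].
exact (continuous_sumr (P := xpredT) cx).
Qed.

Lemma continuous_to_circle : continuous to_circle.
Proof.
apply: continuous_to_subset.
exact: (continuous_unit_vector continuous_bary1 continuous_bary2 bary_gt0).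
Qed.

Lemma continuous_of_circle : continuous of_circle.
Proof.
apply/continuous_to_subset/continuous_to_ptws => v.
have cb w : continuous (tent^~ w).
  apply: continuous_maxr; first exact: continuous_const.
  apply: continuous_subr; last exact: continuous_const.
  by apply: continuous_addr; apply: continuous_mulr;
    (exact: continuous_sphere1_coord || exact: continuous_const).
have csum := continuous_sumr (P := xpredT) cb.
by apply: (continuous_divr (cb v) csum) => z; rewrite gt_eqF// tent_sum_gt0.
Qed.

(** The normalized mean of [x] stays in the cone of a triangle supporting [x], so its image under
    [of_circle] is supported on that same triangle. *)
Lemma homotopic_of_to_circle : homotopic R (of_circle \o to_circle) id.
Proof.
apply: homotopic_realization => [||x].
- exact: (continuous_compf continuous_of_circle continuous_to_circle).
- exact: continuous_idfun.
- have [x0 x1 _] := set_valP x; have [k kn xk] := strip_support x.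
  exists [set v | cyc_near n (idx v) k]%SET; first exact: strip_face.
  move=> v; rewrite inE => -[|/xk//]; rewrite to_subsetK.
  apply: of_circle_near => //; rewrite to_subsetK !mxE/=.
  apply: in_coneZ; last exact: (bary_in_cone x0 kn xk).
  by rewrite invr_ge0 ltW// norm2_gt0// bary_gt0.
Qed.

(** Every vertex of nonzero weight has projection above [c] on [z], hence so has their mean up to
    equality; thus [z] and its image are not antipodal. *)
Lemma dot_to_of_circle z :
  0 < set_val (to_circle (of_circle z)) ord0 ord0 * set_val z ord0 ord0 +
      set_val (to_circle (of_circle z)) ord0 ord_max * set_val z ord0 ord_max.
Proof.
rewrite to_subsetK !mxE/= !(mulrAC _ _^-1) -mulrDl divr_gt0 ?norm2_gt0 ?bary_gt0//.
rewrite bary_proj to_subsetK (lt_le_trans c0)//.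
have -> : c = \sum_v of_circle_fun z v * c.
  by rewrite -mulr_suml of_circle_sum mul1r.
apply: ler_sum => v _.
have [->|/of_circle_neq0 h] := eqVneq (of_circle_fun z v) 0; first by rewrite !mul0r.
by apply: ler_wpM2l; [exact: of_circle_ge0|exact: ltW].
Qed.

(** A segment between unit vectors with positive dot product avoids the origin, so it can be
    normalized. *)
Lemma homotopic_to_of_circle : homotopic R (to_circle \o of_circle) id.
Proof.
pose a z := set_val (to_circle (of_circle z)) ord0 ord0.
pose b z := set_val (to_circle (of_circle z)) ord0 ord_max.
pose u t z := (1 - t) * a z + t * set_val z ord0 ord0.
pose w t z := (1 - t) * b z + t * set_val z ord0 ord_max.
have uw t z : 0 <= t <= 1 -> 0 < u t z ^+ 2 + w t z ^+ 2.
  move=> /andP[t0 t1]; have zz := sphere1_sumsq z.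
  have ab := sphere1_sumsq (to_circle (of_circle z)).
  have := dot_to_of_circle z; rewrite -/(a z) -/(b z) in ab *.
  rewrite /u /w; move: (a z) (b z) (set_val z ord0 ord0) (set_val z ord0 ord_max) ab zz.
  move=> a' b' x y ab zz d.
  have -> : ((1 - t) * a' + t * x) ^+ 2 + ((1 - t) * b' + t * y) ^+ 2 =
    (1 - t) ^+ 2 * (a' ^+ 2 + b' ^+ 2) + t ^+ 2 * (x ^+ 2 + y ^+ 2) +
    2 * (t * (1 - t)) * (a' * x + b' * y) by ring.
  rewrite ab zz !mulr1; apply: ltr_wpDr; last by nra.
  by rewrite mulr_ge0 ?(ltW d)// mulr_ge0// mulr_ge0// subr_ge0.
pose h z t := unit_vector (u t z) (w t z).
have ct := continuous_compf (@continuous_clamp R) (@continuous_snd (sphere R 1) R).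
have cl (f : sphere R 1 -> R) i : continuous f ->
    continuous (fun p : sphere R 1 * R => (1 - clamp p.2) * f p.1 +
      clamp p.2 * set_val p.1 ord0 i).
  move=> cf; apply: continuous_addr; apply: continuous_mulr.
  - by apply: continuous_subr => //; exact: continuous_const.
  - exact: (continuous_compf cf continuous_fst).
  - exact: ct.
  - exact: (continuous_compf (@continuous_sphere1_coord R i) continuous_fst).
have cfg i : continuous (fun z => set_val (to_circle (of_circle z)) ord0 i).
  apply: (continuous_compf (@continuous_sphere1_coord R i)).
  exact: (continuous_compf continuous_to_circle continuous_of_circle).
apply: (@homotopic_in_subset _ _ _ _ _ _ h) => [|z t t01|z|z].
- by apply: (continuous_unit_vector (cl _ _ (cfg _)) (cl _ _ (cfg _))) => p;
    apply: uw; exact: clamp_itv.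
- exact/unit_vector_sphere/uw.
- by rewrite /h /u /w subr0 !mul1r !mul0r !addr0 unit_vector_id.
- by rewrite /h /u /w subrr !mul1r !mul0r !add0r unit_vector_id.
Qed.

Lemma homotopy_equivalent_strip :
  homotopy_equivalent R (realization R K) (sphere R 1).
Proof.
exists to_circle, of_circle; split.
- exact: continuous_to_circle.
- exact: continuous_of_circle.
- exact: homotopic_of_to_circle.
- exact: homotopic_to_of_circle.
Qed.

End CyclicStrip.

(** * Circulant graphs and independent sets of the ladder *)

Lemma inj_surj_bijective (T : Type) (U : Type) (f : T -> U) :
  injective f -> (forall y, exists x, f x = y) -> bijective f.
Proof.
move=> fI fS; exists (fun y => projT1 (cid (fS y))) => [x|y].
  by apply: fI; case: cid.
by case: cid.
Qed.

(** Compares two graphs through a common set of labels, here ['I_n * bool]. *)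
Lemma graph_isomorphic_param (T : Type) (G H : sgraph)
    (f : T -> G) (g : T -> H) : bijective f -> bijective g ->
  (forall a b, edge (f a) (f b) = edge (g a) (g b)) -> graph_isomorphic G H.
Proof.
move=> [f' ff' f'f] [g' gg' g'g] fg; exists (g \o f'); split.
  by exists (f \o g') => x /=; rewrite ?gg' ?ff' ?f'f ?g'g.
by move=> x y; rewrite /= -fg !f'f.
Qed.

Section Circulant.
Context (n : nat) (n3 : 3 <= n).

Definition strip_index (a : 'I_n * bool) : nat := a.1 + (if a.2 then n else 0).

Lemma strip_index_lt a : strip_index a < n.*2.
Proof. by case: a => -[i /= ?] []; rewrite /strip_index /=; lia. Qed.

Lemma strip_index_surj k : k < n.*2 -> exists a, strip_index a = k.
Proof.
move=> kn; have [kn'|nk] := ltnP k n.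
  by exists (Ordinal kn', false); rewrite /strip_index/= addn0.
have kn' : k - n < n by lia.
by exists (Ordinal kn', true); rewrite /strip_index/= subnK.
Qed.

(* For [i, j < 2n]: [i] and [j + n] differ by at most one modulo [2n]. *)
Definition cyc_far (i j : nat) : bool :=
  n.-1 <= (i - j) + (j - i) <= n.+1.

(** The neighbors of k are the labels within one of k + n, so neighborhoods are exactly the
    triangles of the strip, with centres shifted by n. *)
Lemma homotopy_equivalent_circulant (R : realType) (G : sgraph)
    (f : 'I_n * bool -> G) : bijective f ->
  (forall a b, edge (f a) (f b) = cyc_far (strip_index a) (strip_index b)) ->
  homotopy_equivalent R (realization R (neighborhood_complex G)) (sphere R 1).
Proof.
move=> [g fg gf] fE.
have gE x y : edge x y = cyc_far (strip_index (g x)) (strip_index (g y)).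
  by rewrite -fE !gf.
apply: (homotopy_equivalent_strip R n3 (idx := strip_index \o g)) => [v|k kn|A].
- exact: strip_index_lt.
- by have [a <-] := strip_index_surj kn; exists (f a); rewrite /= fg.
- have farE (j k : nat) : j < n.*2 -> k < n.*2 ->
      cyc_near n j (if k < n then k + n else k - n) = cyc_far k j.
    by move=> jn kn; rewrite /cyc_near /cyc_far; case: ltnP; lia.
  rewrite inE; split=> [/existsP[v /forall_inP vA]|[k kn kA]].
  + have kn := strip_index_lt (g v); set k := strip_index (g v) in kn.
    exists (if k < n then k + n else k - n); first by case: (ltnP k n); lia.
    by move=> w /vA; rewrite gE farE ?strip_index_lt.
  (* The shift by n modulo 2n is an involution: the vertex opposite the centre is the common
     neighbor. *)
  + have k'n : (if k < n then k + n else k - n) < n.*2 by case: (ltnP k n); lia.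
    have [a aE] := strip_index_surj k'n.
    apply/existsP; exists (f a); apply/forall_inP => w /kA.
    rewrite gE fg aE -farE ?strip_index_lt// [X in _ -> is_true (cyc_near _ _ X)](_ : _ = k)//.
    by case: (ltnP k n) => ?; case: ltnP; lia.
Qed.

End Circulant.

Section Ladder.
Context (n : nat).

(** Turns the cyclic successor into arithmetic for [lia]; with [1 < n] no listed adjacency is a
    loop, so the test [x != y] disappears. *)
Lemma CL_edgeE (x y : 'I_n * bool) : 1 < n -> CL_edge x y =
  ((x.2 == y.2) && [|| y.1 == x.1.+1 :> nat, x.1 == y.1.+1 :> nat,
     (x.1.+1 == n) && (y.1 == 0 :> nat) | (y.1.+1 == n) && (x.1 == 0 :> nat)])
  || ((x.1 == y.1) && (x.2 != y.2)).
Proof.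
case: x y => [[i iN] b] [[j jN] b'] n1.
have ordSE k (kN : k < n) : val (ordS (Ordinal kN)) = if k.+1 == n then 0 else k.+1.
  by rewrite /=; case: eqP => [->|?]; rewrite ?modnn// modn_small//; lia.
rewrite /CL_edge/= xpair_eqE -!val_eqE !ordSE /=.
by case: b b' => -[] /=; case: (eqVneq i.+1 n) => ?; case: (eqVneq j.+1 n) => ? /=; lia.
Qed.

(** The parity twist makes a step along either cycle change the label by n + 1 or n - 1 modulo 2n
    when n is odd, while a rung changes it by n. *)
Definition CL_param (a : 'I_n * bool) : CL n := (a.1, odd a.1 (+) a.2).

Lemma CL_param_bij : bijective CL_param.
Proof. by exists CL_param => -[i b]; rewrite /CL_param/= addKb. Qed.

Lemma CL_param_edge : 1 < n -> odd n -> forall a b,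
  edge (CL_param a) (CL_param b) = cyc_far n (strip_index a) (strip_index b).
Proof.
move=> n1 nodd [[i iN] e] [[j jN] e']; rewrite /edge/= CL_edgeE//= -val_eqE/=.
have -> : cyc_far n (strip_index (Ordinal iN, e)) (strip_index (Ordinal jN, e')) =
    if e == e' then (i.+1 == n) && (j == 0) || (j.+1 == n) && (i == 0)
    else [|| j == i.+1, i == j.+1 | i == j].
  by rewrite /strip_index /cyc_far/=; case: e; case: e' => /=; lia.
have odd_pred k : k.+1 = n -> odd k = false.
  by move=> kn; move: nodd; rewrite -kn /= => /negPf.
(* Parity facts are recorded as boolean implications, so that the atoms can be abstracted and the
   goal checked by truth table. *)
have : (j == i.+1) ==> (odd j == ~~ odd i) by apply/implyP => /eqP ->.
have : (i == j.+1) ==> (odd i == ~~ odd j) by apply/implyP => /eqP ->.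
have : (i.+1 == n) && (j == 0) ==> (odd i == odd j).
  by apply/implyP => /andP[/eqP/odd_pred -> /eqP ->].
have : (j.+1 == n) && (i == 0) ==> (odd i == odd j).
  by apply/implyP => /andP[/eqP/odd_pred -> /eqP ->].
have : (i == j) ==> (odd i == odd j) by apply/implyP => /eqP ->.
move: (i == j) (_ && _) (_ && _) (i == j.+1) (j == i.+1) (odd i) (odd j).
by case: e e' => [] [] [] [] [] [] [] [] [].
Qed.


Definition shift_sign (a : 'I_n * bool) (j : nat) : bool :=
  odd j (+) a.2 (+) (odd n && (j < a.1)).

(* The independent set missing rung [a.1]: signs alternate along the other rungs,
   and for odd [n] the passage from rung [n - 1] to rung [0] shifts the phase. *)
Definition alt_set (a : 'I_n * bool) : {set CL n} :=
  [set x : CL n | (x.1 != a.1) && (x.2 == shift_sign a x.1)]%SET.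

(** The phase changes only across the missing rung or, for odd n, between rungs n - 1 and 0, where
    it makes up for their equal parity. *)
Lemma alt_set_kindep a : 1 < n ->
  independent (alt_set a) && (#|alt_set a| == n.-1).
Proof.
move=> n1; apply/andP; split.
  apply/forall_inP => -[[j jN] b]; rewrite inE => /andP[/= ja /eqP/= bE].
  apply/forall_inP => -[[k kN] b']; rewrite inE => /andP[/= ka /eqP/= bE'].
  rewrite CL_edgeE//= bE bE' /shift_sign {bE bE'}.
  case: a ja ka => -[i iN] e /=; rewrite -!val_eqE/= => ji ki.
  have step m : m.+1 != i -> (m.+1 < i) = (m < i) by lia.
  have wrap m : m.+1 = n -> odd n = ~~ odd m /\ (m < i) = false.
    by move=> mn; split; [rewrite -mn|lia].
  apply/negP => /orP[/andP[/eqP + /or4P[]]|/andP[/eqP -> /eqP//]].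
  - move=> + /eqP kE; rewrite kE in ki *; rewrite step//=.
    by case: (odd j) e (_ && _) => [] [] [].
  - move=> + /eqP jE; rewrite jE in ji *; rewrite step//=.
    by case: (odd k) e (_ && _) => [] [] [].
  - move=> + /andP[/eqP jn /eqP k0]; rewrite k0 in ki *.
    have [-> ->] := wrap _ jn; rewrite lt0n eq_sym ki.
    by case: (odd j) e => [] [].
  - move=> + /andP[/eqP kn /eqP j0]; rewrite j0 in ji *.
    have [-> ->] := wrap _ kn; rewrite lt0n eq_sym ji.
    by case: (odd k) e => [] [].
(* The set is the graph of the sign function over the remaining n - 1 rungs. *)
pose f (j : 'I_n) : CL n := (j, shift_sign a j).
have -> : alt_set a = (f @: [set~ a.1])%SET.
  apply/setP => -[j b]; rewrite inE; apply/idP/imsetP => /=.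
    by move=> /andP[ja /eqP ->]; exists j; rewrite ?inE.
  by move=> [k]; rewrite !inE => ka [-> ->]; rewrite ka eqxx.
rewrite card_imset; first by rewrite cardsC1 card_ord.
by move=> j k [].
Qed.

Definition alt_vertex (n1 : 1 < n) (a : 'I_n * bool) : indep_graph (CL n) n.-1 :=
  exist _ (alt_set a) (alt_set_kindep a n1).

Lemma alt_set_disjointP a b : reflect
  (forall j : 'I_n, j != a.1 -> j != b.1 -> shift_sign a j != shift_sign b j)
  [disjoint alt_set a & alt_set b].
Proof.
apply: (iffP idP) => [ab j ja jb|ab].
  apply/eqP => eab; move: ab; rewrite disjoint_subset => /fintype.subsetP.
  move=> /(_ (j, shift_sign a j)); rewrite !inE/= ja eqxx => /(_ isT).
  by rewrite ?inE/= jb eab eqxx.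
rewrite disjoint_subset; apply/fintype.subsetP => -[j e]; rewrite !inE/=.
move=> /andP[ja /eqP ->]; rewrite negb_and negbK.
by have [//|/(ab _ ja)] := eqVneq j b.1.
Qed.

(** A nonempty set is not disjoint from itself, so the inequality test in [kindep_edge] is
    automatic. *)
Lemma alt_vertex_edge (n1 : 1 < n) a b :
  edge (alt_vertex n1 a) (alt_vertex n1 b) = [disjoint alt_set a & alt_set b].
Proof.
rewrite /edge/= /kindep_edge/=; case: (boolP [disjoint _ & _]); last by rewrite andbF.
rewrite andbT => dab; apply/eqP => abE.
have := alt_set_kindep a n1; move: dab; rewrite -[alt_set b]/(val (alt_vertex n1 b)).
rewrite -abE /= -setI_eq0 finset.setIid => /eqP ->.
by rewrite cards0 => /andP[_ /eqP]; lia.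
Qed.

(** The signs must differ on every rung other than i and k. For [e = e'] all those rungs must lie
    between i and k, so these are 0 and n - 1; for [e != e'] none may, so i and k differ by at most
    one. *)
Lemma alt_vertex_edge_odd (n1 : 1 < n) a b : 2 < n -> odd n ->
  edge (alt_vertex n1 a) (alt_vertex n1 b) =
  cyc_far n (strip_index a) (strip_index b).
Proof.
move=> n3 nodd; rewrite alt_vertex_edge; apply/alt_set_disjointP/idP.
  case: a b => -[i iN] e [[k kN] e'] /= h; apply: contraT.
  rewrite /cyc_far /strip_index/= => nf.
  have [j [jN ji jk jE]] : exists j, [/\ j < n, j != i, j != k &
      e (+) (j < i) = e' (+) (j < k)].
    have [ee'|ee'] := eqVneq e e'.
      rewrite -{}ee' in nf *.
      (* An end rung lying outside the interval from [i] to [k]. *)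
      exists (if (i == 0) || (k == 0) then n.-1 else 0).
      by case: e {h} nf; case: (eqVneq i 0); case: (eqVneq k 0) => /=; split; lia.
    have {ee'} e'E : e' = ~~ e by case: e e' ee' {h nf} => -[].
    (* The first rung strictly between [i] and [k]. *)
    rewrite {}e'E {h} in nf *; exists (minn i k).+1.
    by case: e nf => /= nf; split; lia.
  have := h (Ordinal jN); rewrite -!val_eqE/= => /(_ ji jk).
  by rewrite /shift_sign/= nodd/= -!addbA jE eqxx.
move=> ab j; move: ab.
case: a b j => -[i iN] e [[k kN] e'] [j jN].
rewrite /shift_sign /strip_index /cyc_far -!val_eqE /=.
by case: e; case: e' => /=; lia.
Qed.

(** Without a phase shift the signs differ on all common rungs or on none, and three rungs leave at
    least one in common. *)
Lemma alt_vertex_edge_even (n1 : 1 < n) a b : 2 < n -> ~~ odd n ->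
  edge (alt_vertex n1 a) (alt_vertex n1 b) = (a.2 != b.2).
Proof.
move=> n3 nodd; rewrite alt_vertex_edge; apply/alt_set_disjointP/idP; last first.
  by move=> ab j _ _; rewrite /shift_sign (negPf nodd) !addbF; lia.
have [j ja jb] : exists2 j : 'I_n, j != a.1 & j != b.1.
  have : 0 < #|~: [set a.1; b.1]%SET|.
    have := cardsC [set a.1; b.1]%SET; rewrite card_ord cards2.
    by case: (_ != _) => /=; lia.
  move=> /card_gt0P[j]; rewrite !inE negb_or => /andP[]; by exists j.
by move=> /(_ j ja jb); rewrite /shift_sign (negPf nodd) !addbF; lia.
Qed.

(** The missing rung can be read off the set; the sign on any other rung then determines [e]. *)
Lemma alt_vertex_inj (n1 : 1 < n) : injective (alt_vertex n1).
Proof.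
move=> a b /(congr1 val)/= /setP abE.
have ab1 : a.1 = b.1.
  apply/eqP; have := abE (a.1, shift_sign b a.1); rewrite !inE/= !eqxx/= andbT.
  by move/esym/negbFE.
have [j ja] : exists j : 'I_n, j != a.1.
  have : 0 < #|[set~ a.1]%SET| by rewrite cardsC1 card_ord; lia.
  by move=> /card_gt0P[j]; rewrite !inE; exists j.
have := abE (j, shift_sign a j); rewrite !inE/= -ab1 ja eqxx /=.
rewrite /shift_sign -ab1 => /esym.
case: a b ab1 {abE ja} => i e [i' e'] /= -> h; congr pair; lia.
Qed.

(** * Every independent set of size n - 1 is alternating *)

Section Surjectivity.
Context (n1 : 1 < n) (A : kindep (CL n) n.-1).

Let Aind (x y : CL n) : x \in val A -> y \in val A -> ~~ edge x y.
Proof.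
by have /andP[/forall_inP h _] := valP A; move=> /h /forall_inP; apply.
Qed.

Let fst_inj : {in val A &, injective (fun x : CL n => x.1)}.
Proof.
move=> [i b] [j b'] /= xA yA ij; move: (Aind xA yA); rewrite /edge/= CL_edgeE//= ij eqxx.
by rewrite negb_or => /andP[_]; rewrite negbK => /eqP ->.
Qed.

(** The ends of a rung are adjacent, so n - 1 independent vertices occupy n - 1 of the n rungs. *)
Lemma missing_rung : exists i : 'I_n,
  forall j : 'I_n, (j == i) = ~~ [exists b, (j, b) \in val A].
Proof.
have /andP[_ /eqP Acard] := valP A.
have : #|~: [set x.1 | x : CL n in val A]%SET| == 1.
  have := cardsC [set x.1 | x : CL n in val A]%SET.
  by rewrite card_in_imset// Acard card_ord; lia.
move=> /cards1P[i /setP iE]; exists i => j.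
have := iE j; rewrite !inE => <-; congr (~~ _).
apply/imsetP/existsP => [[[k b] kA ->]|[b jA]]; first by exists b.
by exists (j, b).
Qed.

Lemma alt_vertex_surj : exists a, alt_vertex n1 a = A.
Proof.
have [i iE] := missing_rung.
(* The sign of [A] on rung [j], with default [false] on the missing rung. *)
pose beta (j : nat) := [exists x in val A, (x.1 == j :> nat) && x.2].
have betaE (j : 'I_n) b : (j, b) \in val A -> beta j = b.
  move=> jA; apply/existsP/idP => [[y /andP[yA /andP[/eqP/val_inj yj y2]]]|b1].
    by have := fst_inj yA jA yj; case: y y2 {yA yj} => ? ? /= + [_ <-].
  by exists (j, b); rewrite jA eqxx.
have memE (x : CL n) : x.1 != i -> (x \in val A) = (x.2 == beta x.1).
  rewrite iE negbK => /existsP[b xA]; rewrite (betaE _ _ xA).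
  case: x xA => j b' /= xA; apply/idP/eqP => [/betaE <-|->//].
  exact: betaE.
have edgeF (j k : nat) (jN : j < n) (kN : k < n) : j != i -> k != i ->
    ~~ CL_edge (Ordinal jN, beta j) (Ordinal kN, beta k).
  move=> ji ki; have := @Aind (Ordinal jN, beta j) (Ordinal kN, beta k).
  by rewrite !memE//=; apply; rewrite eqxx.
have alt j : j.+1 < n -> j != i -> j.+1 != i -> beta j.+1 = ~~ beta j.
  move=> jn ji j1i; have jN : j < n by lia.
  by have := edgeF _ _ jN jn ji j1i; rewrite CL_edgeE//=; lia.
have wrap : 0 != i -> n.-1 != i -> beta 0 = ~~ beta n.-1.
  move=> i0 im; have N0 : 0 < n by lia.
  have Nm : n.-1 < n by lia.
  by have := edgeF _ _ N0 Nm i0 im; rewrite CL_edgeE//=; lia.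
have iN := ltn_ord i.
have up k : i + k.+1 < n -> beta (i + k.+1) = beta i.+1 (+) odd k.
  elim: k => [|k IHk] h; first by rewrite addn1 addbF.
  by rewrite addnS alt ?IHk/=; lia.
have down k : k < i -> beta k = beta 0 (+) odd k.
  elim: k => [|k IHk] h; first by rewrite addbF.
  by rewrite alt ?IHk/=; lia.
(* Solve the sign equation on the first rung after [i], which is rung 0 when [i] is the last one. *)
pose e := if i.+1 == n then beta 0 (+) odd n else beta i.+1 (+) odd i.+1.
exists (i, e); apply: val_inj; apply/setP => x; rewrite inE/=.
have [xi|xi] := eqVneq x.1 i.
  apply/esym/negbTE; apply/negP => xA; have := iE i; rewrite eqxx => /esym/negP.
  by apply; apply/existsP; exists x.2; rewrite -xi -surjective_pairing.
rewrite memE//; case: x xi => -[j jN] b; rewrite /shift_sign -val_eqE /= => xi.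
congr (_ == _).
have [xlti|] := ltnP j i.
  rewrite (down _ xlti) /e; have [iE'|iN'] := eqVneq i.+1 n; first lia.
  (* The path from rung i + 1 reaches the rungs before [i] through the last rung, which brings in
     the parity of n. *)
  have -> : beta 0 = ~~ beta n.-1 by apply: wrap; lia.
  have -> : beta n.-1 = beta i.+1 (+) odd (n.-1 - i.+1).
    by rewrite -up; [congr beta|]; lia.
  rewrite oddB; last lia.
  have -> : odd n = ~~ odd n.-1 by lia.
  move: (beta _) (odd _) (odd _) (odd _) => b' o1 o2 o3.
  by case: b' o1 o2 o3 => [] [] [] [].
rewrite leq_eqVlt eq_sym (negPf xi) /= => ix.
have -> : beta j = beta i.+1 (+) odd (j - i.+1).
  by rewrite -up; [congr beta|]; lia.
have -> : e = beta i.+1 (+) odd i.+1 by rewrite /e ifN_eq//; lia.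
rewrite andbF addbF oddB//; move: (beta _) (odd _) (odd _) => b' o1 o2.
by case: b' o1 o2 => [] [] [].
Qed.
End Surjectivity.

End Ladder.

Theorem theorem4p6 (R : realType) (n : nat) (hn : (3 <= n)%N) :
  let H := indep_graph (CL n) n.-1 in
  (odd n ->
    [/\ graph_isomorphic H (CL n),
        homeomorphic (realization R (neighborhood_complex H))
                     (realization R (neighborhood_complex (CL n)))
      & homotopy_equivalent R (realization R (neighborhood_complex H))
                              (sphere R 1)]) /\
  (~~ odd n ->
    homotopy_equivalent R (realization R (neighborhood_complex H))
                          (sphere R 0)).
Proof.
have n1 : 1 < n := ltnW hn; move=> H.
have bijH : bijective (alt_vertex n1).
  exact: inj_surj_bijective (@alt_vertex_inj n n1) (alt_vertex_surj n1).
split=> [nodd|neven].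
- have edgeH a b := alt_vertex_edge_odd n1 a b hn nodd.
  have isoH : graph_isomorphic H (CL n).
    apply: (graph_isomorphic_param bijH (@CL_param_bij n)) => a b.
    by rewrite edgeH CL_param_edge.
  split=> //; first exact: homeomorphic_neighborhood_complex.
  exact: (homotopy_equivalent_circulant hn R bijH edgeH).
- have [g fg gf] := bijH; have n0 : 0 < n by exact: ltnW.
  (* The colour is the sign in the label; missing rung 0 supplies one vertex of each colour. *)
  apply: (@homotopy_equivalent_bipartite R H (fun x => (g x).2)
    (alt_vertex n1 (Ordinal n0, false)) (alt_vertex n1 (Ordinal n0, true))).
  + by rewrite fg.
  + by rewrite fg.
  + by move=> x y; rewrite -(alt_vertex_edge_even n1 (g x) (g y) hn neven) !gf.
Qed.
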